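(* Let $\mathbf{A}=\mathbf{H}+\mathbf{Z}$ on $[a,b]$ and $\mathbf{F}$ be as in the context, let $\mathbf{M}(x)$ be a fundamental matrix of $\mathbf{y}_0'=\mathbf{H}(x)\mathbf{y}_0$ on $[a,b]$, let $x_0\in[a,b]$, and let $\mathbf{c}=(c_1,\ldots,c_n)^T$ be a constant vector. Write $\mathbf{N}(t)=\mathbf{M}^{-1}(t)\mathbf{Z}(t)\mathbf{M}(t)$. (i) Define $\tilde\Phi_0(x)=\mathbf{M}(x)\mathbf{c}$ and, for $j=1,2,3,\ldots$, $$\tilde\Phi_j(x)=\mathbf{M}(x)\int_{x_0}^{x}\mathbf{N}(t_j)\int_{x_0}^{t_j}\mathbf{N}(t_{j-1})\cdots\int_{x_0}^{t_2}\mathbf{N}(t_1)\,\mathbf{c}\;dt_1\,dt_2\cdots dt_j .$$ Then on $[a,b]$ one has $\tilde\Phi_0'=\mathbf{H}(x)\tilde\Phi_0$ and $\tilde\Phi_j'=\mathbf{H}(x)\tilde\Phi_j+\mathbf{Z}(x)\tilde\Phi_{j-1}$ for all $j\ge 1$. (ii) Define $\bar\Phi_0(x)=\mathbf{M}(x)\mathbf{c}+\mathbf{M}(x)\int_{x_0}^{x}\mathbf{M}^{-1}(t)\mathbf{F}(t)\,dt$ and, for $j=1,2,3,\ldots$, $$\bar\Phi_j(x)=\mathbf{M}(x)\int_{x_0}^{x}\mathbf{N}(t_j)\int_{x_0}^{t_j}\mathbf{N}(t_{j-1})\cdots\int_{x_0}^{t_2}\mathbf{M}^{-1}(t_1)\mathbf{Z}(t_1)\Big(\mathbf{M}(t_1)\mathbf{c}+\mathbf{M}(t_1)\int_{x_0}^{t_1}\mathbf{M}^{-1}(t)\mathbf{F}(t)\,dt\Big)dt_1\,dt_2\cdots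 dt_j .$$ Then on $[a,b]$ one has $\bar\Phi_0'=\mathbf{H}(x)\bar\Phi_0+\mathbf{F}(x)$ and $\bar\Phi_j'=\mathbf{H}(x)\bar\Phi_j+\mathbf{Z}(x)\bar\Phi_{j-1}$ for all $j\ge 1$.
   Context: Here $[a,b]$ is a real interval and $n\ge 1$. $\mathbf{A}(x)=(a_{ij}(x))$ is an $n\times n$ matrix function, nonsingular, with entries continuous on $[a,b]$; $\mathbf{F}(x)=(f_1(x),\ldots,f_n(x))^T$ is a vector function with entries continuous on $[a,b]$. The matrix function $\mathbf{A}$ is split as $\mathbf{A}(x)=\mathbf{H}(x)+\mathbf{Z}(x)$, where $\mathbf{H}(x)$ and $\mathbf{Z}(x)$ are nonsingular $n\times n$ matrices, the entries of $\mathbf{Z}(x)$ are finite on $[a,b]$, and $\mathbf{H}(x)$ is either a matrix function on $[a,b]$ or a constant matrix. A prime denotes $d/dx$. A fundamental matrix of $\mathbf{y}_0'=\mathbf{H}(x)\mathbf{y}_0$ is an $n\times n$ matrix function whose columns are $n$ linearly independent solutions on $[a,b]$, linear independence of $n$ solutions being equivalent to their Wronskian (the determinant of this matrix) being nonzero for all $x\in[a,b]$. For $j=1$ the iterated integrals are single integrals over $t_1$ from $x_0$ to $x$. *)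

(* Defs.v *)
From HB Require Import structures.
From mathcomp Require Import all_boot all_order all_algebra.
From mathcomp Require Import all_classical all_reals all_analysis.

Set Implicit Arguments.
Unset Strict Implicit.
Unset Printing Implicit Defensive.

Import Order.TTheory GRing.Theory Num.Theory.
Import numFieldNormedType.Exports.
Local Open Scope classical_set_scope.
Local Open Scope ring_scope.

(* Derivative relative to [a, b]: two-sided in the interior, one-sided at the
   endpoints.  Values of f outside [a, b] play no role. *)
Definition has_deriv_on (R : realType) (a b : R) (f : R -> R) (x l : R) : Prop :=
  (f y - f x) / (y - x) @[y --> within `[a, b] x^'] --> l.

Definition has_vderiv_on (R : realType) (n : nat) (a b : R)
    (y : R -> 'cV[R]_n) (x : R) (l : 'cV[R]_n) : Prop :=
  forall i, has_deriv_on a b (fun t => y t i 0) x (l i 0).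

Definition continuous_entries (R : realType) (m n : nat) (a b : R)
    (A : R -> 'M[R]_(m, n)) : Prop :=
  forall i j, {within `[a, b], continuous (fun x => A x i j : R)}.

(* Values in R are never infinite, so finiteness of the entries on [a, b] is
   boundedness there. *)
Definition finite_entries (R : realType) (m n : nat) (a b : R)
    (A : R -> 'M[R]_(m, n)) : Prop :=
  forall i j, [bounded (A x i j : R^o) | x in `[a, b]].

Definition nonsingular_on (R : realType) (n : nat) (a b : R)
    (A : R -> 'M[R]_n) : Prop :=
  forall x : R, x \in `[a, b] -> A x \in unitmx.

Definition homogeneous_solution (R : realType) (n : nat) (a b : R)
    (H : R -> 'M[R]_n) (y : R -> 'cV[R]_n) : Prop :=
  forall x : R, x \in `[a, b] -> has_vderiv_on a b y x (H x *m y x).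

(* Linear independence is that of the columns as functions on [a, b]. *)
Definition fundamental_matrix (R : realType) (n : nat) (a b : R)
    (H M : R -> 'M[R]_n) : Prop :=
  (forall j, homogeneous_solution a b H (fun x => col j (M x))) /\
  (forall k : 'I_n -> R,
     (forall x : R, x \in `[a, b] -> \sum_j k j *: col j (M x) = 0) ->
     forall j, k j = 0).

(* Oriented Lebesgue integral of f from x0 to x, where x < x0 is allowed. *)
Definition oriented_integral (R : realType) (x0 x : R) (f : R -> R) : R :=
  if x0 <= x then \int[lebesgue_measure]_(t in `[x0, x]) f t
  else - \int[lebesgue_measure]_(t in `[x, x0]) f t.

Definition vintegral (R : realType) (n : nat) (x0 x : R)
    (v : R -> 'cV[R]_n) : 'cV[R]_n :=
  \col_i oriented_integral x0 x (fun t => v t i 0).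

(* The (k+1)-fold integral
   \int_x0^x N(t_{k+1}) \int_x0^{t_{k+1}} N(t_k) ... \int_x0^{t_2} u(t_1)
   dt_1 ... dt_{k+1}. *)
Fixpoint iterated_integral (R : realType) (n : nat) (x0 : R)
    (N : R -> 'M[R]_n) (u : R -> 'cV[R]_n) (k : nat) (x : R) : 'cV[R]_n :=
  match k with
  | 0 => vintegral x0 x u
  | k'.+1 => vintegral x0 x (fun t => N t *m iterated_integral x0 N u k' t)
  end.

Definition conjugated (R : realType) (n : nat) (M Z : R -> 'M[R]_n) (t : R)
    : 'M[R]_n :=
  invmx (M t) *m Z t *m M t.

Definition Phi_tilde (R : realType) (n : nat) (x0 : R) (M Z : R -> 'M[R]_n)
    (c : 'cV[R]_n) (j : nat) (x : R) : 'cV[R]_n :=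
  match j with
  | 0 => M x *m c
  | k.+1 => M x *m iterated_integral x0 (conjugated M Z)
                     (fun t => conjugated M Z t *m c) k x
  end.

Definition Phi_bar0 (R : realType) (n : nat) (x0 : R) (M : R -> 'M[R]_n)
    (F : R -> 'cV[R]_n) (c : 'cV[R]_n) (x : R) : 'cV[R]_n :=
  M x *m c + M x *m vintegral x0 x (fun t => invmx (M t) *m F t).

Definition Phi_bar (R : realType) (n : nat) (x0 : R) (M Z : R -> 'M[R]_n)
    (F : R -> 'cV[R]_n) (c : 'cV[R]_n) (j : nat) (x : R) : 'cV[R]_n :=
  match j with
  | 0 => Phi_bar0 x0 M F c x
  | k.+1 => M x *m iterated_integral x0 (conjugated M Z)
                     (fun t => invmx (M t) *m Z t *m Phi_bar0 x0 M F c t) k x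
  end.

(* Main.v *)
Require Import Defs.
From HB Require Import structures.
From mathcomp Require Import all_boot all_order all_algebra.
From mathcomp Require Import all_classical all_reals all_analysis.
From mathcomp Require Import measurable_realfun ring lra.
Import Order.TTheory GRing.Theory Num.Theory.
Import numFieldNormedType.Exports.
Local Open Scope classical_set_scope.
Local Open Scope ring_scope.

(** Formally the statement is variation of constants: if [w' = dw] then
[(M w)' = H (M w) + M dw], and [M N v = Z (M v)] for [N = M^-1 Z M], so each
differentiation peels off the outermost integral
([perturbation_recursion]).  What needs proof is that [M] is invertible at
every point of the interval, and that the integrals can be differentiated at every
point although [Z], hence [N], need not be continuous.

Nonsingularity of [M] comes from uniqueness for [y' = H y].  As [A] is
continuous and [Z] bounded, [H = A - Z] is bounded, so [f = |y|^2] satisfies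
[|f'| <= C f], and a solution that vanishes at one point vanishes identically
([homogeneous_solution_eq0]); applied to [M v], this turns linear independence
of the columns as functions into nonsingularity at each point
([fundamental_matrix_nonsingular]).

For the integrals, substitute [Z = A - H] and [H M = M'] to get
[N = M^-1 A M - M^-1 M'].  The first term is continuous; the second is a sum of
products of continuous functions with bounded derivatives.  Call [f] exact when
it is bounded, measurable, and the derivative of its Lebesgue integral at every
point of the interval.  Bounded derivatives are exact
([bounded_derivative_exact]: dominated convergence of difference quotients),
and exactness survives sums and multiplication by a continuous function
([exact_derivativeM]: freezing the continuous factor at the base point costs
only [o(h)], the other factor being bounded).  Hence [N] has exact entries
([exact_entries_conjugated]), and so does [N] times any continuous vector, in
particular every integrand of the iterated integrals
([has_vderiv_on_iterated_integral]). *)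

(** * Derivatives relative to a closed interval *)

Section RelativeDerivative.
Context {R : realType}.
Implicit Types (a b c d h x y k l K : R) (f g df : R -> R).

Lemma has_deriv_onP a b f x l : has_deriv_on a b f x l <->
  forall e, 0 < e -> exists2 d, 0 < d & forall y, y \in `[a, b] ->
    `|y - x| < d -> `|f y - f x - l * (y - x)| <= e * `|y - x|.
Proof.
rewrite /has_deriv_on; split.
  move/cvgrPdist_le => h e /h.
  rewrite near_withinE near_withinE => -[d d0 hd]; exists d => // y yab yx.
  have [->|nyx] := eqVneq y x; first by rewrite !subrr mulr0 subrr normr0 mulr0.
  have := hd y; rewrite /ball /= distrC => /(_ yx nyx yab).
  rewrite -(ler_pM2r (x := `|y - x|)) ?normr_gt0 ?subr_eq0//.
  by rewrite -normrM mulrBl divfK ?subr_eq0// distrC.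
move=> h; apply/cvgrPdist_le => e /h[d d0 hd].
rewrite near_withinE near_withinE; exists d => // y /=.
rewrite /ball /= distrC => yx nyx yab.
rewrite -(ler_pM2r (x := `|y - x|)) ?normr_gt0 ?subr_eq0//.
by rewrite -normrM mulrBl divfK ?subr_eq0// distrC; exact: hd.
Qed.

Lemma continuous_itvP a b f : {within `[a, b], continuous f} <->
  forall x, x \in `[a, b] -> forall e, 0 < e -> exists2 d, 0 < d &
    forall y, y \in `[a, b] -> `|y - x| < d -> `|f y - f x| <= e.
Proof.
split=> [/subspace_continuousP h x xab e e0|h].
  have /cvgrPdist_le/(_ e e0) := h x xab.
  rewrite near_withinE => -[d d0 hd]; exists d => // y yab yx.
  by rewrite distrC; apply: (hd y) => //; rewrite /ball /= distrC.
apply/subspace_continuousP => x xab; apply/cvgrPdist_le => e e0.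
have [d d0 hd] := h x xab e e0; rewrite near_withinE; exists d => // y /=.
by rewrite /ball /= distrC => yx yab; rewrite distrC; apply: hd.
Qed.

Lemma is_derive_has_deriv_on {a b f x l} :
  is_derive x 1 f l -> has_deriv_on a b f x l.
Proof.
move=> [df dfl]; apply/has_deriv_onP => e e0.
have : h^-1 *: ((f \o shift x) (h *: 1) - f x) @[h --> 0^'] --> l.
  by rewrite -dfl; exact: df.
move=> /cvgrPdist_le/(_ e e0); rewrite near_withinE => -[d d0 hd].
exists d => // y _ yx; have [->|nyx] := eqVneq y x.
  by rewrite !subrr mulr0 subrr normr0 mulr0.
have y0 : y - x != 0 by rewrite subr_eq0.
have := hd (y - x); rewrite /ball /= sub0r normrN => /(_ yx y0).
rewrite /GRing.scale /= mulr1 subrK -(ler_pM2r (x := `|y - x|)) ?normr_gt0//.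
by rewrite -normrM mulrBl mulrAC mulVf// mul1r distrC.
Qed.

Lemma has_deriv_on_eq {a b} f {g x l} : {in `[a, b], f =1 g} -> x \in `[a, b] ->
  has_deriv_on a b f x l -> has_deriv_on a b g x l.
Proof.
move=> fg xab /has_deriv_onP h; apply/has_deriv_onP => e /h[d d0 hd].
by exists d => // y yab yx; rewrite -!fg//; exact: hd.
Qed.

Lemma has_deriv_on_cst a b x (k : R) : has_deriv_on a b (fun=> k) x 0.
Proof.
apply/has_deriv_onP => e e0; exists 1 => // y _ _.
by rewrite subrr mul0r subr0 normr0 mulr_ge0// ltW.
Qed.

Lemma has_deriv_on_subr a b x : has_deriv_on a b (fun y => y - a) x 1.
Proof.
apply/has_deriv_onP => e e0; exists 1 => // y _ _.
by rewrite mul1r opprB addrA subrK subrr normr0 mulr_ge0// ltW.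
Qed.

Lemma has_deriv_onD {a b f g x k l} : has_deriv_on a b f x k ->
  has_deriv_on a b g x l -> has_deriv_on a b (fun y => f y + g y) x (k + l).
Proof.
move=> hf hg; apply: cvg_trans (cvgD hf hg); apply: near_eq_cvg.
apply: nearW => y; rewrite /= !fctE /=. by rewrite -mulrDl; congr (_ / _); ring.
Qed.

Lemma has_deriv_on_sum {a b} {I : finType} {f : I -> R -> R} {x} {l : I -> R} :
  (forall i, has_deriv_on a b (f i) x (l i)) ->
  has_deriv_on a b (fun y => \sum_i f i y) x (\sum_i l i).
Proof.
move=> h; elim: (index_enum I) => [|i r ih].
  by rewrite big_nil; under eq_fun do rewrite big_nil; exact: has_deriv_on_cst.
rewrite big_cons; under eq_fun do rewrite big_cons.
exact: has_deriv_onD (h i) ih.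
Qed.

(** Differentiability gives continuity along the punctured filter, which is
what the product rule uses. *)
Lemma has_deriv_on_cvg {a b f x l} : has_deriv_on a b f x l ->
  f y @[y --> within `[a, b] x^'] --> f x.
Proof.
move=> hf; rewrite -[X in _ --> X]addr0 -[X in _ + X](mulr0 l).
have hx : y - x @[y --> within `[a, b] x^'] --> (0 : R).
  rewrite -(subrr x); apply: cvgB; last exact: cvg_cst.
  by do 2! apply: cvg_within_filter; exact: cvg_id.
apply: cvg_trans (cvgD (cvg_cst (f x)) (cvgM hf hx)).
apply: near_eq_cvg; rewrite near_withinE.
apply: filterS (nbhs_dnbhs_neq x) => y yx _ /=.
rewrite !fctE /=. by rewrite divfK ?subr_eq0// addrC subrK.
Qed.

Lemma has_deriv_onM {a b f g x k l} : has_deriv_on a b f x k ->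
  has_deriv_on a b g x l ->
  has_deriv_on a b (fun y => f y * g y) x (k * g x + f x * l).
Proof.
move=> hf hg.
apply: cvg_trans
  (cvgD (cvgM hf (has_deriv_on_cvg hg)) (cvgM (cvg_cst (f x)) hg)).
apply: near_eq_cvg; apply: nearW => y; rewrite /= !fctE /=. by ring.
Qed.

Lemma has_deriv_on_continuous {a b f df} :
  (forall x, x \in `[a, b] -> has_deriv_on a b f x (df x)) ->
  {within `[a, b], continuous f}.
Proof.
move=> h; apply/continuous_itvP => x xab e e0.
have /has_deriv_onP/(_ 1 ltr01)[d d0 hd] := h x xab.
have s0 : 0 < 1 + `|df x| by rewrite ltr_pwDl.
exists (Num.min d (e / (1 + `|df x|))).
  by rewrite lt_min d0 divr_gt0.
move=> y yab; rewrite lt_min ltr_pdivlMr// => /andP[yd ye].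
have := hd y yab yd; rewrite mul1r => H.
apply: le_trans (ltW ye); rewrite mulrDr mulr1 (mulrC `|_|) -normrM.
apply: le_trans (lerD H (lexx _)).
by rewrite -[X in `|X| <= _](subrK (df x * (y - x))) ler_normD.
Qed.

(** In the interior the relative derivative is the ordinary one, so the
classical mean value theorem applies. *)
Lemma has_deriv_on_MVT {a b f df} {x y : R} :
  (forall x, x \in `[a, b] -> has_deriv_on a b f x (df x)) ->
  x \in `[a, b] -> y \in `[a, b] -> x < y ->
  exists2 c, c \in `[a, b] & f y - f x = df c * (y - x).
Proof.
move=> h xab yab xy.
have sub c : c \in `[x, y] -> c \in `[a, b].
  by move: xab yab; rewrite !in_itv /=; lra.
have cf : {within `[x, y], continuous f}.
  by apply: continuous_subspaceW (has_deriv_on_continuous h) => c; apply: sub.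
have hderiv c : c \in `]x, y[ -> is_derive c 1 f (df c).
  move=> cxy.
  have /has_deriv_onP hc : has_deriv_on a b f c (df c).
    by apply: h; apply: sub; exact: subset_itv_oo_cc.
  have hq : h^-1 *: ((f \o shift c) (h *: 1) - f c) @[h --> 0^'] --> df c.
    apply/cvgrPdist_le => e /hc[d d0 hd].
    have dd0 : 0 < Num.min d (Num.min (c - x) (y - c)).
      by move: cxy; rewrite !lt_min d0 !subr_gt0 in_itv.
    rewrite near_withinE; exists (Num.min d (Num.min (c - x) (y - c))) => // t.
    rewrite /ball /= sub0r normrN !lt_min => /andP[td /andP[tx ty]] t0.
    have tcab : t + c \in `[a, b].
      apply: sub; rewrite in_itv /=; move: tx ty.
      by rewrite !ltr_norml; lra.
    rewrite /GRing.scale /= mulr1 -(ler_pM2r (x := `|t|)) ?normr_gt0// -normrM.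
    rewrite mulrBl mulrAC mulVf// mul1r distrC.
    by have := hd _ tcab; rewrite addrK; exact.
  apply: DeriveDef; first by apply/cvg_ex; exists (df c); exact: hq.
  exact/cvg_lim.
have [c cxy ->] := MVT xy hderiv cf.
by exists c => //; apply: sub; exact: subset_itv_oo_cc.
Qed.

Lemma has_deriv_on_lipschitz {a b f df K x y} :
  (forall x, x \in `[a, b] -> has_deriv_on a b f x (df x)) ->
  (forall x, x \in `[a, b] -> `|df x| <= K) ->
  x \in `[a, b] -> y \in `[a, b] -> `|f y - f x| <= K * `|y - x|.
Proof.
move=> h hK xab yab.
wlog xy : x y xab yab / x <= y => [wl|].
  by have [/wl->//|/ltW/wl] := leP x y; rewrite distrC (distrC y x) => ->.
move: xy; rewrite le_eqVlt => /predU1P[->|xy].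
  by rewrite !subrr normr0 mulr0.
have [c cab ->] := has_deriv_on_MVT h xab yab xy.
by rewrite normrM ler_wpM2r// hK.
Qed.

Lemma has_deriv_on_monotone {a b f df x y} :
  (forall x, x \in `[a, b] -> has_deriv_on a b f x (df x)) ->
  (forall x, x \in `[a, b] -> 0 <= df x) ->
  x \in `[a, b] -> y \in `[a, b] -> x <= y -> f x <= f y.
Proof.
move=> h hdf xab yab; rewrite le_eqVlt => /predU1P[->//|xy].
have [c cab E] := has_deriv_on_MVT h xab yab xy.
rewrite -subr_ge0 E; apply: mulr_ge0; first exact: hdf.
by rewrite subr_ge0 ltW.
Qed.

Lemma has_deriv_onW {a b} {a' b' : R} {f x l} : `[a', b'] `<=` `[a, b] ->
  has_deriv_on a b f x l -> has_deriv_on a' b' f x l.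
Proof.
move=> sab /has_deriv_onP h; apply/has_deriv_onP => e /h[d d0 hd].
by exists d => // y /sab; exact: hd.
Qed.

Lemma has_deriv_on_shift {a b} {a' b' : R} {f x h l} :
  (forall y, y \in `[a', b'] -> y + h \in `[a, b]) ->
  has_deriv_on a b f (x + h) l -> has_deriv_on a' b' (fun y => f (y + h)) x l.
Proof.
move=> sab /has_deriv_onP H; apply/has_deriv_onP => e /H[d d0 hd].
exists d => // y /sab yab yx; have := hd _ yab.
by rewrite opprD addrACA subrr addr0; exact.
Qed.

(** The right difference quotients along the steps [1/(n+1)]; the right end
is excluded so that the shifted points eventually lie in the interval. *)
Lemma has_deriv_on_seq {a b f x l} : x \in `[a, b[ -> has_deriv_on a b f x l ->
  (f (x + n.+1%:R^-1) - f x) * n.+1%:R @[n --> \oo] --> l.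
Proof.
move=> xab /has_deriv_onP h; apply/cvgrPdist_le => e /h[d d0 hd].
move: xab; rewrite in_itv /= => /andP[ax xb].
have m0 : 0 < Num.min d (b - x) by rewrite lt_min d0 subr_gt0.
apply: filterS (near_infty_natSinv_lt (PosNum m0)) => n /=.
rewrite lt_min => /andP[nd nb].
have N0 : (0 : R) < n.+1%:R by rewrite ltr0n.
move: nd nb; set N : R := n.+1%:R in N0 * => nd nb.
have p0 : 0 < N^-1 by rewrite invr_gt0.
have := hd (x + N^-1); rewrite in_itv /= addrAC subrr add0r gtr0_norm//.
have -> : l - (f (x + N^-1) - f x) * N = - ((f (x + N^-1) - f x - l / N) * N).
  by field; exact: lt0r_neq0.
rewrite normrN normrM (gtr0_norm N0) -ler_pdivlMr//; apply => //.
by rewrite ler_wpDr ?(ltW p0)//= -lerBrDl ltW.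
Qed.

Lemma has_deriv_on_unique_primitive {a b f g} df :
  (forall x, x \in `[a, b] -> has_deriv_on a b f x (df x)) ->
  (forall x, x \in `[a, b] -> has_deriv_on a b g x (df x)) ->
  f a = g a -> {in `[a, b], f =1 g}.
Proof.
move=> hf hg fga x xab; have aab : a \in `[a, b].
  by move: xab; rewrite !in_itv /= lexx => /andP[/le_trans h /h].
pose u y := f y + -1 * g y.
have hu y : y \in `[a, b] -> has_deriv_on a b u y 0.
  move=> yab; have := has_deriv_onD (hf y yab)
    (has_deriv_onM (has_deriv_on_cst a b y (-1)) (hg y yab)).
  by rewrite mul0r add0r mulN1r subrr.
have h0 y : y \in `[a, b] -> `|(0 : R)| <= 0 by rewrite normr0.
have := has_deriv_on_lipschitz (df := fun=> 0) hu h0 aab xab.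
rewrite mul0r normr_le0 subr_eq0 => /eqP.
by rewrite /u fga !mulN1r subrr => /eqP; rewrite subr_eq0 => /eqP.
Qed.

End RelativeDerivative.

(** * Bounded measurable functions on an interval *)

Section BoundedMeasurable.
Context {R : realType}.
Implicit Types (a b x y k : R) (f g : R -> R).

Definition bounded_on a b f := exists K, forall x, x \in `[a, b] -> `|f x| <= K.

Lemma bounded_onD {a b f g} : bounded_on a b f -> bounded_on a b g ->
  bounded_on a b (fun x => f x + g x).
Proof.
move=> [K hK] [L hL]; exists (K + L) => x xab.
by rewrite (le_trans (ler_normD _ _))// lerD ?hK ?hL.
Qed.

Lemma bounded_onM {a b f g} : bounded_on a b f -> bounded_on a b g ->
  bounded_on a b (fun x => f x * g x).
Proof.
move=> [K hK] [L hL]; exists (K * L) => x xab.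
by rewrite normrM ler_pM ?hK ?hL.
Qed.

Lemma bounded_on_sum {a b} {I : finType} (f : I -> R -> R) :
  (forall i, bounded_on a b (f i)) -> bounded_on a b (fun x => \sum_i f i x).
Proof.
move=> h; elim: (index_enum I) => [|i r ih].
  by under eq_fun do rewrite big_nil; exists 0 => x _; rewrite normr0.
by under eq_fun do rewrite big_cons; exact: bounded_onD.
Qed.

Lemma continuous_bounded_on {a b f} : {within `[a, b], continuous f} ->
  bounded_on a b f.
Proof.
move=> cf; have := continuous_compact cf (segment_compact (a := a) (b := b)).
move=> /compact_bounded[K [_ hK]]; exists (K + 1) => x xab.
by apply: hK => /=; [rewrite ltrDl|exists x].
Qed.

Definition bounded_measurable a b f :=
  measurable_fun `[a, b] f /\ bounded_on a b f.

Lemma bounded_measurableM {a b f g} : bounded_measurable a b f ->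
  bounded_measurable a b g -> bounded_measurable a b (fun x => f x * g x).
Proof.
move=> [mf bf] [mg bg]; split; [exact: measurable_funM|exact: bounded_onM].
Qed.

Lemma bounded_measurableD {a b f g} : bounded_measurable a b f ->
  bounded_measurable a b g -> bounded_measurable a b (fun x => f x + g x).
Proof.
move=> [mf bf] [mg bg]; split; [exact: measurable_funD|exact: bounded_onD].
Qed.

Lemma continuous_bounded_measurable {a b f} : {within `[a, b], continuous f} ->
  bounded_measurable a b f.
Proof.
move=> cf; split; last exact: continuous_bounded_on.
exact: subspace_continuous_measurable_fun.
Qed.

Lemma continuous_itv_cst a b k : {within `[a, b], continuous (fun=> k)}.
Proof. by move=> x; exact: cvg_cst. Qed.

Lemma bounded_measurable_cst a b k : bounded_measurable a b (fun=> k).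
Proof. exact/continuous_bounded_measurable/continuous_itv_cst. Qed.

Lemma bounded_measurable_integrable {a b f} {D : interval R} :
  bounded_measurable a b f -> [set` D] `<=` `[a, b] ->
  lebesgue_measure.-integrable [set` D] (EFin \o f).
Proof.
move=> [mf [K hK]] Dab; apply: measurable_bounded_integrable => //.
- apply: (@le_lt_trans _ _ (lebesgue_measure `[a, b])).
    by apply: le_measure => //; rewrite inE; exact: measurable_itv.
  by rewrite lebesgue_measure_itv /=; case: ifP; rewrite ?ltry// -EFinB ltry.
- exact: measurable_funS mf.
- exists K; split; first exact: num_real.
  by move=> M KM x /= xD; rewrite (le_trans _ (ltW KM))// hK//; exact: Dab.
Qed.

Lemma subset_itvcc a b x y (l r : bool) : x \in `[a, b] -> y \in `[a, b] ->
  [set` Interval (BSide l x) (BSide r y)] `<=` `[a, b].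
Proof.
rewrite !in_itv /= => /andP[ax _] /andP[_ yb] t /=; rewrite !in_itv /=.
by case: l; case: r => /=; lra.
Qed.

End BoundedMeasurable.

(** * Indefinite Lebesgue integrals *)

Section Primitive.
Context {R : realType}.
Implicit Types (a b x y k : R) (f g : R -> R).

Definition primitive a f x : R := \int[lebesgue_measure]_(t in `[a, x]) f t.

Lemma primitive_id a f : primitive a f a = 0.
Proof. by rewrite /primitive set_itv1 Rintegral_set1. Qed.

Lemma primitiveB {a b f x y} : bounded_measurable a b f ->
  x \in `[a, b] -> y \in `[a, b] -> x <= y ->
  primitive a f y - primitive a f x = \int[lebesgue_measure]_(t in `[x, y]) f t.
Proof.
move=> bf xab yab xy; have aab : a \in `[a, b].
  by move: xab; rewrite !in_itv /= lexx => /andP[/le_trans h /h].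
have ax : a <= x by move: xab; rewrite in_itv /= => /andP[].
rewrite /primitive Rintegral_itvB//.
- rewrite Rintegral_itv_obnd_cbnd//.
  by apply: bounded_measurable_integrable bf _; exact: subset_itvcc.
- by apply: bounded_measurable_integrable bf _; exact: subset_itvcc.
Qed.

Lemma oriented_integralE {a b f x0 x} : bounded_measurable a b f ->
  x0 \in `[a, b] -> x \in `[a, b] ->
  oriented_integral x0 x f = primitive a f x - primitive a f x0.
Proof.
move=> bf x0ab xab; rewrite /oriented_integral; case: leP => [xx0|/ltW xx0].
  by rewrite -(primitiveB bf).
by rewrite -(primitiveB bf)// opprB.
Qed.

Lemma primitiveD {a b f g x} : bounded_measurable a b f ->
  bounded_measurable a b g -> x \in `[a, b] ->
  primitive a (fun t => f t + g t) x = primitive a f x + primitive a g x.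
Proof.
move=> bf bg xab; have aab : a \in `[a, b].
  by move: xab; rewrite !in_itv /= lexx => /andP[/le_trans h /h].
by rewrite /primitive RintegralD//; apply: bounded_measurable_integrable;
  do ?[eassumption|exact: subset_itvcc].
Qed.

Lemma primitiveZ {a b f x} k : bounded_measurable a b f ->
  x \in `[a, b] ->
  primitive a (fun t => k * f t) x = k * primitive a f x.
Proof.
move=> bf xab; have aab : a \in `[a, b].
  by move: xab; rewrite !in_itv /= lexx => /andP[/le_trans h /h].
by rewrite /primitive RintegralZl//; apply: bounded_measurable_integrable;
  do ?[eassumption|exact: subset_itvcc].
Qed.

Lemma primitive1 a x : a <= x -> primitive a (fun=> 1) x = x - a.
Proof.
move=> ax; rewrite /primitive Rintegral_cst// mul1r /= lebesgue_measure_itv /=.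
rewrite lte_fin.
by case: ltgtP ax => // ->; rewrite subrr.
Qed.

(** The bound on [f] is asked only at the points as close to [x] as [y] is,
so that it can be taken small when [f] is continuous and vanishes at [x]. *)
Lemma primitive_increment_le {a b f x y} k : bounded_measurable a b f ->
  x \in `[a, b] -> y \in `[a, b] ->
  (forall t, t \in `[a, b] -> `|t - x| <= `|y - x| -> `|f t| <= k) ->
  `|primitive a f y - primitive a f x| <= k * `|y - x|.
Proof.
have key u v : bounded_measurable a b f -> u \in `[a, b] -> v \in `[a, b] ->
    u <= v -> (forall t, t \in `[u, v] -> `|f t| <= k) ->
    `|primitive a f v - primitive a f u| <= k * (v - u).
  move=> bf uab vab uv hk; rewrite (primitiveB bf)//.
  have suv : `[u, v] `<=` `[a, b] by exact: subset_itvcc.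
  have If := bounded_measurable_integrable bf suv.
  have Ik := bounded_measurable_integrable (bounded_measurable_cst a b k) suv.
  apply: le_trans (le_normr_Rintegral _ If) _ => //.
  apply: le_trans (le_Rintegral (f2 := fun=> k) _ _ Ik _) _ => //.
  - by apply: integrable_norm.
  - rewrite Rintegral_cst//= lebesgue_measure_itv /= lte_fin.
    by case: ltgtP uv => // -> _; rewrite subrr.
move=> bf xab yab hk; have [xy|/ltW yx] := leP x y.
  rewrite (ger0_norm (x := y - x)) ?subr_ge0//.
  apply: key => // t txy; apply: hk.
    by move: t txy; exact: subset_itvcc.
  move: txy; rewrite in_itv /= => /andP[xt ty].
  by rewrite !ger0_norm ?subr_ge0// lerD2r.
rewrite distrC (distrC y) (ger0_norm (x := x - y)) ?subr_ge0//.
apply: key => // t txy; apply: hk.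
  by move: t txy; exact: subset_itvcc.
move: txy; rewrite in_itv /= => /andP[xt ty].
by rewrite distrC (distrC y) !ger0_norm ?subr_ge0// lerD2l lerN2.
Qed.

End Primitive.

(** * Functions that are everywhere the derivative of their integral *)

Section ExactDerivative.
Context {R : realType}.
Implicit Types (a b x y k : R) (f g df : R -> R).

(** Every point of the interval is required, not almost every one: this is
what makes the differential equations hold everywhere. *)
Definition exact_derivative a b f := bounded_measurable a b f /\
  forall x, x \in `[a, b] -> has_deriv_on a b (primitive a f) x (f x).

Lemma exact_derivative_eq {a b} f {g} : {in `[a, b], f =1 g} ->
  exact_derivative a b f -> exact_derivative a b g.
Proof.
move=> fg [[mf [K hK]] df]; split.
  split; last by exists K => x xab; rewrite -fg//; exact: hK.
  by apply: eq_measurable_fun mf => x; rewrite inE => xab; exact: fg.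
move=> x xab; rewrite -fg//; apply: has_deriv_on_eq (df x xab) => // y yab.
apply: eq_Rintegral => t; rewrite inE /= => ty; apply: fg.
by move: ty yab; rewrite !in_itv /=; lra.
Qed.

Lemma exact_derivativeD {a b f g} : exact_derivative a b f ->
  exact_derivative a b g -> exact_derivative a b (fun x => f x + g x).
Proof.
move=> [bf df] [bg dg]; split; first exact: bounded_measurableD.
move=> x xab.
apply: has_deriv_on_eq (has_deriv_onD (df x xab) (dg x xab)) => //.
by move=> y yab; rewrite (primitiveD bf).
Qed.

(** Split [g f = g x * f + (g - g x) * f].  The integral of the first part has
derivative [g x * f x] at [x]; the second integrand is at most [e] near [x],
since [f] is bounded and [g] continuous, so its integral has derivative [0]. *)
Lemma exact_derivativeM {a b f g} : {within `[a, b], continuous g} ->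
  exact_derivative a b f -> exact_derivative a b (fun x => g x * f x).
Proof.
move=> cg [bf df]; have bg := continuous_bounded_measurable cg.
have bgf := bounded_measurableM bg bf; split => // x xab.
pose h t := (g t - g x) * f t.
have bh : bounded_measurable a b h.
  by apply: bounded_measurableM bf; apply: bounded_measurableD bg _;
    exact: bounded_measurable_cst.
have E y : y \in `[a, b] -> primitive a (fun t => g t * f t) y =
    g x * primitive a f y + primitive a h y.
  move=> yab; rewrite -(primitiveZ _ bf)// -(primitiveD _ bh)//; last first.
    by apply: bounded_measurableM => //; exact: bounded_measurable_cst.
  by congr (primitive a _ y); apply/funext => t; rewrite /h; ring.
have [K hK] := bf.2.
have K0 : 0 <= K by rewrite (le_trans _ (hK x xab)).
have dh : has_deriv_on a b (primitive a h) x 0.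
  apply/has_deriv_onP => e e0.
  have K1 : 0 < K + 1 by rewrite ltr_pwDr.
  have [d d0 hd] := (continuous_itvP a b g).1 cg x xab _ (divr_gt0 e0 K1).
  exists d => // y yab yd; rewrite mul0r subr0.
  apply: (primitive_increment_le _ bh) => // t tab ty.
  rewrite /h normrM -(divfK (lt0r_neq0 K1) e).
  rewrite ler_pM ?hd ?(le_lt_trans ty)//.
  by rewrite (le_trans (hK t tab))// lerDl.
have dgf := has_deriv_onM (has_deriv_on_cst a b x (g x)) (df x xab).
have := has_deriv_onD dgf dh.
rewrite mul0r add0r addr0; apply: has_deriv_on_eq => // y yab.
by rewrite E.
Qed.

Lemma exact_derivative_sum {a b} {I : finType} {f : I -> R -> R} :
  (forall i, exact_derivative a b (f i)) ->
  exact_derivative a b (fun x => \sum_i f i x).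
Proof.
move=> h; elim: (index_enum I) => [|i r ih].
  under eq_fun do rewrite big_nil; split; first exact: bounded_measurable_cst.
  move=> x xab; rewrite /primitive.
  under eq_fun do rewrite Rintegral_cst// mul0r.
  exact: has_deriv_on_cst.
by under eq_fun do rewrite big_cons; exact: exact_derivativeD.
Qed.

Lemma exact_derivative1 a b : exact_derivative a b (fun=> 1).
Proof.
split; first exact: bounded_measurable_cst.
move=> x xab; apply: has_deriv_on_eq (has_deriv_on_subr a b x) => // y.
by rewrite in_itv /= => /andP[ay _]; rewrite primitive1.
Qed.

(** A continuous function is its product with the exact function [1]. *)
Lemma continuous_exact_derivative {a b f} : {within `[a, b], continuous f} ->
  exact_derivative a b f.
Proof.
move=> cf.
apply: exact_derivative_eq (exact_derivativeM cf (exact_derivative1 a b)).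
by move=> x _; rewrite mulr1.
Qed.

(** It suffices that the Lebesgue integral of [df] recovers [f].  Extend [f]
by constants outside the interval; the extension is Lipschitz by the mean value
theorem, so its difference quotients [q n] are uniformly bounded and dominated
convergence applies to their integrals.  Since the extension is continuous, the
integral of [q n] is a combination of difference quotients of its primitive,
and these converge to [f x - f a]. *)
Lemma bounded_derivative_exact {a b} f {df} : a < b ->
  (forall x, x \in `[a, b] -> has_deriv_on a b f x (df x)) ->
  bounded_on a b df -> exact_derivative a b df.
Proof.
move=> ab hf [K hK].
have K0 : 0 <= K by rewrite (le_trans _ (hK a _))// in_itv /= lexx ltW.
(* the extension of f by its end values *)
pose ff t := f (Num.max a (Num.min b t)).
have clampE t : t \in `[a, b] -> ff t = f t.
  by rewrite in_itv /= => /andP[at_ tb]; rewrite /ff min_r// max_r.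
have clamp_in t : Num.max a (Num.min b t) \in `[a, b].
  by rewrite in_itv /= le_max lexx /= ge_max (ltW ab) ge_min lexx.
have lipff u v : `|ff v - ff u| <= K * `|v - u|.
  apply: le_trans (has_deriv_on_lipschitz hf hK (clamp_in u) (clamp_in v)) _.
  rewrite ler_wpM2l// /Num.max /Num.min.
  repeat case: ifP; move=> *; rewrite ler_norml; have := ler_norm (v - u);
    by have := ler_normr (u - v) (v - u); lra.
have cff c d : {within `[c, d], continuous ff}.
  apply/continuous_itvP => x _ e e0; exists (e / (K + 1)).
    by rewrite divr_gt0// ltr_pwDr.
  move=> y _ yx; apply: le_trans (lipff x y) _.
  rewrite -(divfK (lt0r_neq0 (_ : 0 < K + 1)) e) ?ltr_pwDr// mulrC.
  by rewrite ler_pM// ?lerDl// ltW.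
pose h n : R := n.+1%:R^-1.
pose q n t : R := (ff (t + h n) - ff t) * n.+1%:R.
have h01 n : 0 <= h n <= 1.
  by rewrite /h invr_ge0 ler0n /= invf_le1 ?ler1n ?ltr0n.
have hfx x : x \in `[a, b] -> has_deriv_on a b ff x (df x).
  move=> xab; apply: has_deriv_on_eq (hf x xab) => // y yab.
  by rewrite clampE.
have qcvg x : x \in `[a, b[ -> q n x @[n --> \oo] --> df x.
  move=> xab; apply: (has_deriv_on_seq xab).
  by apply: hfx; exact: subset_itv_co_cc xab.
have qK n x : `|q n x| <= K.
  rewrite normrM (gtr0_norm (x := n.+1%:R)) ?ltr0n// -ler_pdivlMr ?ltr0n//.
  apply: le_trans (lipff _ _) _.
  by rewrite addrAC subrr add0r ger0_norm//; have /andP[] := h01 n.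
have shift_cont n c d : {within `[c, d], continuous (fun t => ff (t + h n))}.
  apply/continuous_itvP => x _ e e0.
  have cx := cff (x + h n - 1) (x + h n + 1).
  have [|d0 d0_ hd] := (continuous_itvP _ _ _).1 cx (x + h n) _ e e0.
    by rewrite in_itv /= gerBl lerDl ler01.
  exists (Num.min d0 1); first by rewrite lt_min d0_ ltr01.
  move=> y _; rewrite lt_min => /andP[yd y1]; apply: hd; last first.
    by rewrite opprD addrACA subrr addr0.
  by move: y1; rewrite ltr_norml in_itv /=; lra.
have Gd := (continuous_exact_derivative (cff a (b + 1))).2.
have qc n : {within `[a, b], continuous (q n)}.
  move=> x.
  by apply: cvgM; [apply: cvgB; [exact: shift_cont|exact: cff]|exact: cvg_cst].
have qm n : bounded_measurable a b (q n).
  exact: continuous_bounded_measurable.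
(* Both sides vanish at a and have derivative q n; the shifted arguments do
   not exceed b + 1, because steps are at most 1. *)
have hq n : {in `[a, b], primitive a (q n) =1 fun x =>
    (primitive a ff (x + h n) - primitive a ff x) * n.+1%:R
    + - (primitive a ff (a + h n) * n.+1%:R)}.
  apply: (has_deriv_on_unique_primitive (q n)).
  - exact: (continuous_exact_derivative (qc n)).2.
  - move=> y yab.
    have yab1 : y \in `[a, b + 1].
      by move: yab; rewrite !in_itv /=; lra.
    have yhab1 z : z \in `[a, b] -> z + h n \in `[a, b + 1].
      by move: (h01 n); rewrite !in_itv /=; lra.
    have d1 : has_deriv_on a b (fun z => primitive a ff (z + h n)) y
        (ff (y + h n)).
      by apply: (has_deriv_on_shift yhab1); apply: Gd; exact: yhab1.
    have d2 : has_deriv_on a b (primitive a ff) y (ff y).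
      apply: has_deriv_onW (Gd y yab1) => z /=.
      by rewrite !in_itv /=; lra.
    have := has_deriv_onD (has_deriv_onM (has_deriv_onD d1
      (has_deriv_onM (has_deriv_on_cst a b y (-1)) d2))
      (has_deriv_on_cst a b y n.+1%:R))
      (has_deriv_on_cst a b y (- (primitive a ff (a + h n) * n.+1%:R))).
    rewrite mul0r add0r mulr0 !addr0 mulN1r; apply: has_deriv_on_eq => // z _.
    by rewrite mulN1r.
  - by rewrite !primitive_id subr0 subrr.
(* The quotients converge to df except perhaps at b, where all steps leave the
   interval. *)
have mdf : measurable_fun `[a, b] df.
  apply/measurable_fun_itv_bndo_bndcP.
  apply: (measurable_fun_cvg (h := q)) => [n|x xab].
    by apply: measurable_funS (qm n).1 => //; exact: subset_itv_co_cc.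
  exact: qcvg.
have bdf : bounded_measurable a b df by split => //; exists K.
have prim x : x \in `[a, b] -> primitive a df x = f x - f a.
  move=> xab.
  have aab : a \in `[a, b] by rewrite in_itv /= lexx ltW.
  have sub : [set` `[a, x[] `<=` `[a, b] by exact: subset_itvcc.
  have Iq n := bounded_measurable_integrable (qm n) sub.
  have Idf := bounded_measurable_integrable bdf sub.
  have IK := bounded_measurable_integrable (bounded_measurable_cst a b K) sub.
  have lim1 : primitive a (q n) x @[n --> \oo] --> primitive a df x.
    rewrite /primitive -Rintegral_itv_bndo_bndc//.
    under eq_fun do rewrite -Rintegral_itv_bndo_bndc//.
    apply: fine_cvg; rewrite fineK; last exact: integrable_fin_num.
    apply: (@dominated_cvg _ _ _ _ _ _ _ _ (EFin \o cst K)) => //.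
    - by move=> n; case/integrableP: (Iq n).
    - move=> t tax; apply: cvg_EFin; first exact: nearW.
      apply: qcvg; move: tax xab; rewrite /= !in_itv /=; lra.
    - by move=> n t _; rewrite /= lee_fin.
  have lim2 : primitive a (q n) x @[n --> \oo] --> ff x - ff a.
    under eq_fun do rewrite hq//.
    have in1 y : y \in `[a, b] -> y \in `[a, b + 1[.
      by rewrite !in_itv /=; lra.
    apply: cvgB.
      apply: (has_deriv_on_seq (in1 x xab)); apply: Gd.
      exact: subset_itv_co_cc (in1 x xab).
    have := has_deriv_on_seq (in1 a aab) (Gd a (subset_itv_co_cc (in1 a aab))).
    by under eq_fun do rewrite primitive_id subr0.
  by rewrite (cvg_unique (@norm_hausdorff _ R) lim1 lim2) !clampE.
split=> // x xab.
apply: (has_deriv_on_eq (fun y => f y + - f a)) => //.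
  by move=> y yab; rewrite prim.
rewrite -[df x]addr0; apply: has_deriv_onD (hf x xab) _.
exact: has_deriv_on_cst.
Qed.
End ExactDerivative.

(** * Continuity of the inverse matrix *)

Section ContinuousInverse.
Context {R : realType} {a b : R}.
Implicit Types (f g : R -> R).

Lemma continuous_itv_eq f {g} : {in `[a, b], f =1 g} ->
  {within `[a, b], continuous f} -> {within `[a, b], continuous g}.
Proof.
move=> fg /continuous_itvP h; apply/continuous_itvP => x xab e e0.
have [d d0 hd] := h x xab e e0.
by exists d => // y yab; rewrite -!fg//; exact: hd.
Qed.

Lemma continuous_itvD {f g} : {within `[a, b], continuous f} ->
  {within `[a, b], continuous g} ->
  {within `[a, b], continuous (fun x => f x + g x)}.
Proof. by move=> cf cg x; exact: cvgD (cf x) (cg x). Qed.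

Lemma continuous_itvM {f g} : {within `[a, b], continuous f} ->
  {within `[a, b], continuous g} ->
  {within `[a, b], continuous (fun x => f x * g x)}.
Proof. by move=> cf cg x; exact: cvgM (cf x) (cg x). Qed.

Lemma continuous_itv_sum {I : Type} (r : seq I) {f : I -> R -> R} :
  (forall i, {within `[a, b], continuous (f i)}) ->
  {within `[a, b], continuous (fun x => \sum_(i <- r) f i x)}.
Proof.
move=> h; elim: r => [|i r ih].
  apply: (continuous_itv_eq (fun=> 0)) (continuous_itv_cst _ _ _) => x _.
  by rewrite big_nil.
apply: continuous_itv_eq (continuous_itvD (h i) ih) => x _.
by rewrite big_cons.
Qed.

Lemma continuous_itv_prod {I : Type} (r : seq I) {f : I -> R -> R} :
  (forall i, {within `[a, b], continuous (f i)}) ->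
  {within `[a, b], continuous (fun x => \prod_(i <- r) f i x)}.
Proof.
move=> h; elim: r => [|i r ih].
  apply: (continuous_itv_eq (fun=> 1)) (continuous_itv_cst _ _ _) => x _.
  by rewrite big_nil.
apply: continuous_itv_eq (continuous_itvM (h i) ih) => x _.
by rewrite big_cons.
Qed.

Lemma continuous_itvV {f} : (forall x, x \in `[a, b] -> f x != 0) ->
  {within `[a, b], continuous f} ->
  {within `[a, b], continuous (fun x => (f x)^-1)}.
Proof.
move=> f0 /subspace_continuousP cf; apply/subspace_continuousP => x xab.
by apply: cvgV; [exact: f0|exact: cf].
Qed.

Lemma continuous_entries_mulmx {m n p : nat} {A : R -> 'M[R]_(m, n)}
    {B : R -> 'M[R]_(n, p)} :
  continuous_entries a b A -> continuous_entries a b B ->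
  continuous_entries a b (fun x => A x *m B x).
Proof.
move=> cA cB i j.
apply: (continuous_itv_eq (fun x => \sum_k A x i k * B x k j)).
  by move=> x _; rewrite mxE.
by apply: continuous_itv_sum => k; exact: continuous_itvM.
Qed.

Lemma continuous_det {n : nat} {A : R -> 'M[R]_n} :
  continuous_entries a b A ->
  {within `[a, b], continuous (fun x => \det (A x))}.
Proof.
move=> cA; apply: continuous_itv_sum => s.
apply: continuous_itvM; first exact: continuous_itv_cst.
by apply: continuous_itv_prod => i; exact: cA.
Qed.

(** By Cramer's formula, the inverse is the adjugate divided by the
determinant. *)
Lemma continuous_entries_invmx {n : nat} {A : R -> 'M[R]_n} :
  nonsingular_on a b A -> continuous_entries a b A ->
  continuous_entries a b (fun x => invmx (A x)).
Proof.
move=> uA cA i j.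
apply: (continuous_itv_eq (fun x => (\det (A x))^-1 * (\adj (A x)) i j)).
  by move=> x xab; rewrite /invmx uA// !mxE.
apply: continuous_itvM.
  apply: continuous_itvV; last exact: continuous_det.
  by move=> x xab; rewrite -unitfE -unitmxE; exact: uA.
apply: (continuous_itv_eq
  (fun x => (-1) ^+ (j + i) * \det (row' j (col' i (A x))))).
  by move=> x _; rewrite mxE.
apply: continuous_itvM; first exact: continuous_itv_cst.
apply: continuous_det => k l.
by apply: continuous_itv_eq (cA (lift j k) (lift i l)) => x _; rewrite !mxE.
Qed.

End ContinuousInverse.

(** * Nonsingularity of fundamental matrices *)

Section Uniqueness.
Context {R : realType}.

Lemma has_deriv_on_expRM (a b k x : R) :
  has_deriv_on a b (fun y => expR (k * y)) x (k * expR (k * x)).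
Proof.
apply: is_derive_has_deriv_on.
have h1 : is_derive x 1 (fun y => k * y) k.
  apply: is_derive_eq. by rewrite /GRing.scale /= mulr1.
have h2 := is_derive_expR (k * x).
by apply: is_derive_eq (is_derive1_comp h2 h1) _; rewrite mulrC.
Qed.

(** A Gronwall argument on both sides of [x1]: the weights [exp (K y)] and
[exp (- K y)] make the nonnegative function [f] monotone towards its zero. *)
Lemma vanish_of_growth {a b K : R} {f df : R -> R} {x1 : R} :
  (forall x, x \in `[a, b] -> has_deriv_on a b f x (df x)) ->
  (forall x, x \in `[a, b] -> 0 <= f x) ->
  (forall x, x \in `[a, b] -> `|df x| <= K * f x) ->
  x1 \in `[a, b] -> f x1 = 0 -> {in `[a, b], forall x, f x = 0}.
Proof.
move=> hf f0 hK x1ab fx1 x xab; apply/eqP; rewrite eq_le f0// andbT.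
have [xx1|/ltW x1x] := leP x x1.
  (* to the left of x1, exp (K y) f y is nondecreasing *)
  have h y : y \in `[a, b] -> has_deriv_on a b (fun y => expR (K * y) * f y) y
      (K * expR (K * y) * f y + expR (K * y) * df y).
    by move=> yab; exact: has_deriv_onM (has_deriv_on_expRM _ _ _ _) (hf y yab).
  have := has_deriv_on_monotone h _ xab x1ab xx1.
  rewrite fx1 mulr0 pmulr_rle0 ?expR_gt0//; apply => y yab.
  rewrite (mulrC K) -mulrA -mulrDr mulr_ge0 ?expR_ge0//.
  by have := hK y yab; rewrite ler_norml => /andP[]; lra.
(* to the right of x1, exp (- K y) f y is nonincreasing *)
have h y : y \in `[a, b] ->
    has_deriv_on a b (fun y => expR (- K * y) * (-1 * f y)) y
    (- K * expR (- K * y) * (-1 * f y)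
     + expR (- K * y) * (0 * f y + -1 * df y)).
  move=> yab; apply: has_deriv_onM; first exact: has_deriv_on_expRM.
  exact: has_deriv_onM (has_deriv_on_cst _ _ _ _) (hf y yab).
have := has_deriv_on_monotone h _ x1ab xab x1x.
rewrite fx1 !mulr0 pmulr_rge0 ?expR_gt0// mulN1r oppr_ge0; apply => y yab.
set E := expR _.
have -> : - K * E * (-1 * f y) + E * (0 * f y + -1 * df y) =
  E * (K * f y - df y) by ring.
rewrite mulr_ge0 ?expR_ge0// subr_ge0.
by have := hK y yab; rewrite ler_norml => /andP[].
Qed.

Lemma bounded_entries_uniform {a b : R} {m n : nat} {A : R -> 'M[R]_(m, n)} :
  (forall i j, bounded_on a b (fun x => A x i j)) ->
  exists K, forall x, x \in `[a, b] -> forall i j, `|A x i j| <= K.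
Proof.
move=> bA.
have [|K hK] := bounded_on_sum (a := a) (b := b) (fun p x => `|A x p.1 p.2|).
  move=> [i j]; have [K hK] := bA i j.
  by exists K => x xab; rewrite normr_id hK.
exists K => x xab i j; apply: le_trans (hK x xab); rewrite (bigD1 (i, j))//=.
by apply: le_trans (ler_norm _); rewrite lerDl sumr_ge0.
Qed.

(** The squared Euclidean norm [f] of [y] satisfies [|f'| <= 2 n K f], where
[K] bounds the entries of [H], by [2 |u v| <= u^2 + v^2]. *)
Lemma homogeneous_solution_eq0 {a b : R} {n : nat} {H : R -> 'M[R]_n}
    {y : R -> 'cV[R]_n} {x1 : R} :
  (forall i j, bounded_on a b (fun x => H x i j)) ->
  homogeneous_solution a b H y ->
  x1 \in `[a, b] -> y x1 = 0 -> {in `[a, b], forall x, y x = 0}.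
Proof.
move=> bH hy x1ab yx1 x xab.
have [K hK] := bounded_entries_uniform bH.
pose f x := \sum_i y x i 0 * y x i 0.
pose df x := \sum_i ((H x *m y x) i 0 * y x i 0 + y x i 0 * (H x *m y x) i 0).
have hf z : z \in `[a, b] -> has_deriv_on a b f z (df z).
  by move=> zab; apply: has_deriv_on_sum => i; apply: has_deriv_onM; exact: hy.
have f0 z : 0 <= f z by apply: sumr_ge0 => i _; rewrite -expr2 sqr_ge0.
have hdf z : z \in `[a, b] -> `|df z| <= (2 * n%:R * K) * f z.
  move=> zab; apply: le_trans (ler_norm_sum _ _ _) _.
  have step i : `|(H z *m y z) i 0 * y z i 0 + y z i 0 * (H z *m y z) i 0| <=
      \sum_j K * (y z j 0 * y z j 0 + y z i 0 * y z i 0).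
    rewrite mulrC -mulr2n -mulr_natl mxE mulr_sumr mulr_sumr.
    apply: le_trans (ler_norm_sum _ _ _) _; apply: ler_sum => j _.
    rewrite !normrM (gtr0_norm (x := 2))//.
    have := hK z zab i j; have := normr_ge0 (H z i j).
    have := sqr_ge0 (`|y z i 0| - `|y z j 0|).
    rewrite -[y z j 0 * _]expr2 -[y z i 0 * y z i 0]expr2.
    rewrite -(real_normK (num_real (y z j 0))).
    rewrite -(real_normK (num_real (y z i 0))).
    have := normr_ge0 (y z i 0); have := normr_ge0 (y z j 0).
    move: `|y z i 0| `|y z j 0| `|H z i j| => u v w v0 u0 uv w0 wK.
    apply: (@le_trans _ _ (2 * (u * (K * v)))).
      by rewrite ler_pM2l// ler_wpM2l// ler_wpM2r.
    by have := mulr_ge0 (le_trans w0 wK) uv; lra.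
  apply: le_trans (ler_sum _ (fun i _ => step i)) _.
  under eq_bigr => i _ do rewrite -mulr_sumr big_split /= sumr_const card_ord.
  rewrite -mulr_sumr big_split /= sumr_const card_ord sumrMnl -/(f z).
  by rewrite -[f z *+ n]mulr_natl le_eqVlt; apply/orP; left; apply/eqP; ring.
have fx1 : f x1 = 0 by rewrite /f yx1 big1// => i _; rewrite mxE mul0r.
have /eqP := vanish_of_growth hf (fun z _ => f0 z) hdf x1ab fx1 x xab.
rewrite /f psumr_eq0 => [/allP h|i _]; last by rewrite -expr2 sqr_ge0.
apply/colP => i; rewrite mxE; apply/eqP.
by have := h i (mem_index_enum i); rewrite /= mulf_eq0 orbb.
Qed.

Lemma fundamental_matrix_entry {a b : R} {n : nat} {H M : R -> 'M[R]_n} :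
  fundamental_matrix a b H M -> forall x, x \in `[a, b] ->
  forall i j, has_deriv_on a b (fun t => M t i j) x ((H x *m M x) i j).
Proof.
move=> [hM _] x xab i j; have := hM j x xab i.
have -> : (H x *m col j (M x)) i 0 = (H x *m M x) i j.
  by rewrite !mxE; apply: eq_bigr => k _; rewrite mxE.
by apply: has_deriv_on_eq => // t _; rewrite mxE.
Qed.

Lemma has_vderiv_on_mulmx {a b : R} {m n : nat} {A : R -> 'M[R]_(m, n)}
    {w : R -> 'cV[R]_n} {x} {dA : 'M[R]_(m, n)} {dw : 'cV[R]_n} :
  (forall i j, has_deriv_on a b (fun t => A t i j) x (dA i j)) ->
  has_vderiv_on a b w x dw -> x \in `[a, b] ->
  has_vderiv_on a b (fun t => A t *m w t) x (dA *m w x + A x *m dw).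
Proof.
move=> hA hw xab i; rewrite !mxE -big_split /=.
apply: (has_deriv_on_eq (fun t => \sum_j A t i j * w t j 0)) => //.
  by move=> t _; rewrite mxE.
by apply: has_deriv_on_sum => j; exact: has_deriv_onM.
Qed.

(** A kernel vector [v] of [M x1] makes [M v] a solution vanishing at [x1],
hence identically; this is a linear relation between the columns. *)
Lemma fundamental_matrix_nonsingular {a b : R} {n : nat} {H M : R -> 'M[R]_n} :
  (forall i j, bounded_on a b (fun x => H x i j)) ->
  fundamental_matrix a b H M -> nonsingular_on a b M.
Proof.
move=> bH fM x1 x1ab; rewrite unitmxE unitfE -det_tr.
apply/negP => /det0P[v v0 vM].
pose y t := M t *m v^T.
have yE t : y t = \sum_j v 0 j *: col j (M t).
  apply/colP => i; rewrite mxE summxE; apply: eq_bigr => j _.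
  by rewrite !mxE mulrC.
have hy : homogeneous_solution a b H y.
  move=> x xab; rewrite mulmxA -[H x *m M x *m _]addr0.
  rewrite -[X in _ + X](mulmx0 _ (M x)).
  apply: has_vderiv_on_mulmx => //; first exact: fundamental_matrix_entry.
  move=> i; rewrite [X in has_deriv_on _ _ _ _ X]mxE.
  exact: has_deriv_on_cst.
have y1 : y x1 = 0 by rewrite /y -[M x1]trmxK -trmx_mul vM trmx0.
have y0 := homogeneous_solution_eq0 bH hy x1ab y1.
have vj := fM.2 (fun j => v 0 j) (fun x xab => etrans (esym (yE x)) (y0 x xab)).
by case/eqP: v0; apply/rowP => j; rewrite vj mxE.
Qed.

End Uniqueness.

(** * Iterated integrals *)

Definition exact_entries {R : realType} (a b : R) {m p : nat}
    (u : R -> 'M[R]_(m, p)) :=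
  forall i j, exact_derivative a b (fun x => u x i j).

Section IteratedIntegrals.
Context {R : realType} {a b : R} {n : nat}.
Implicit Types (u v w : R -> 'cV[R]_n) (N : R -> 'M[R]_n).

Lemma has_deriv_on_continuous_entries {m p : nat} {A : R -> 'M[R]_(m, p)} dA :
  (forall x, x \in `[a, b] ->
    forall i j, has_deriv_on a b (fun t => A t i j) x (dA x i j)) ->
  continuous_entries a b A.
Proof.
move=> hA i j.
apply: (has_deriv_on_continuous (df := fun x => dA x i j)) => x xab.
exact: hA.
Qed.

Lemma has_vderiv_on_continuous {w} dw :
  (forall x, x \in `[a, b] -> has_vderiv_on a b w x (dw x)) ->
  continuous_entries a b w.
Proof.
move=> hw; apply: (has_deriv_on_continuous_entries dw) => x xab i j.
by rewrite ord1; exact: hw.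
Qed.

Lemma exact_entries_mulmx {m p q : nat} {A : R -> 'M[R]_(m, p)}
    {B : R -> 'M[R]_(p, q)} :
  exact_entries a b A -> continuous_entries a b B ->
  exact_entries a b (fun x => A x *m B x).
Proof.
move=> eA cB i j.
apply: (exact_derivative_eq (fun x => \sum_k B x k j * A x i k)).
  by move=> x _; rewrite mxE; apply: eq_bigr => k _; rewrite mulrC.
by apply: exact_derivative_sum => k; exact: exact_derivativeM.
Qed.

Lemma has_vderiv_on_vintegral {x0 u} : x0 \in `[a, b] -> exact_entries a b u ->
  forall x, x \in `[a, b] ->
    has_vderiv_on a b (fun t => vintegral x0 t u) x (u x).
Proof.
move=> x0ab eu x xab i; have [bu du] := eu i 0.
apply: (has_deriv_on_eq (fun t => primitive a (fun s => u s i 0) t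
    + - primitive a (fun s => u s i 0) x0)) => //.
  by move=> t tab; rewrite mxE (oriented_integralE bu).
rewrite -[u x i 0]addr0.
exact: has_deriv_onD (du x xab) (has_deriv_on_cst _ _ _ _).
Qed.

(** Each iterated integral is differentiable, hence continuous, so that [N]
times it is again exact and the next integral can be differentiated. *)
Lemma has_vderiv_on_iterated_integral {x0 N u} k : x0 \in `[a, b] ->
  exact_entries a b N -> exact_entries a b u ->
  forall x, x \in `[a, b] -> has_vderiv_on a b (iterated_integral x0 N u k) x
    (if k is k'.+1 then N x *m iterated_integral x0 N u k' x else u x).
Proof.
move=> x0ab eN eu; elim: k => [|k ih]; apply: has_vderiv_on_vintegral => //.
by apply: exact_entries_mulmx => //; exact: has_vderiv_on_continuous ih.
Qed.

End IteratedIntegrals.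

(** * The conjugated perturbation and the recursion *)

Section Conjugation.
Context {R : realType} {a b : R} {n : nat} {A H Z M : R -> 'M[R]_n}.
Context (uM : nonsingular_on a b M).
Context (dM : forall x, x \in `[a, b] ->
  forall i j, has_deriv_on a b (fun t => M t i j) x ((H x *m M x) i j)).

(** Here [Z M = A M - M'], where [M' = H M] is a bounded derivative. *)
Lemma exact_entries_conjugated : a < b ->
  continuous_entries a b A -> (forall x, x \in `[a, b] -> A x = H x + Z x) ->
  (forall i j, bounded_on a b (fun x => H x i j)) ->
  exact_entries a b (conjugated M Z).
Proof.
move=> ab cA hA bH.
have cM := has_deriv_on_continuous_entries _ dM.
have cV := continuous_entries_invmx uM cM.
have eHM k j : exact_derivative a b (fun x => (H x *m M x) k j).
  apply: (bounded_derivative_exact (fun x => M x k j)) => //.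
    by move=> x xab; exact: dM.
  have [|K hK] := @bounded_on_sum _ a b _ (fun l x => H x k l * M x l j).
    by move=> l; apply: bounded_onM => //; exact/continuous_bounded_on/cM.
  by exists K => x xab; rewrite mxE hK.
move=> i j.
apply: (exact_derivative_eq (fun x => \sum_k (invmx (M x) i k * (A x *m M x) k j
   + (-1 * invmx (M x) i k) * (H x *m M x) k j))).
  move=> x xab; rewrite /conjugated.
  have -> : Z x = A x - H x by rewrite hA// addrC addKr.
  rewrite -mulmxA mulmxBl mulmxBr [RHS]mxE [X in _ = X + _]mxE.
  rewrite [X in _ = _ + X]mxE [X in _ = _ - X]mxE.
  rewrite -sumrN -big_split /=; apply: eq_bigr => k _; ring.
apply: exact_derivative_sum => k; apply: exact_derivativeD.
  apply: exact_derivativeM; first exact: cV.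
  by apply: continuous_exact_derivative; exact: continuous_entries_mulmx.
apply: exact_derivativeM => //; apply: continuous_itvM; last exact: cV.
exact: continuous_itv_cst.
Qed.

(** Variation of constants. *)
Lemma has_vderiv_on_variation {w : R -> 'cV[R]_n} {x} {dw : 'cV[R]_n} :
  x \in `[a, b] -> has_vderiv_on a b w x dw ->
  has_vderiv_on a b (fun t => M t *m w t) x (H x *m (M x *m w x) + M x *m dw).
Proof.
by move=> xab hw; rewrite mulmxA; apply: has_vderiv_on_mulmx => //; exact: dM.
Qed.

Lemma mulmx_conjugated x (v : 'cV[R]_n) : x \in `[a, b] ->
  M x *m (conjugated M Z x *m v) = Z x *m (M x *m v).
Proof. by move=> xab; rewrite /conjugated !mulmxA mulmxV ?uM// mul1mx. Qed.

End Conjugation.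

(** Both families of functions have this form: [v] is the constant vector in
the homogeneous case, and that constant plus the integral of [M^-1 F] in the
other. *)
Lemma perturbation_recursion {R : realType} {n : nat} {a b x0 : R}
    {H Z M : R -> 'M[R]_n} {v : R -> 'cV[R]_n} :
  x0 \in `[a, b] -> nonsingular_on a b M ->
  (forall x, x \in `[a, b] ->
    forall i j, has_deriv_on a b (fun t => M t i j) x ((H x *m M x) i j)) ->
  exact_entries a b (conjugated M Z) -> continuous_entries a b v ->
  let N := conjugated M Z in
  let Phi k t := M t *m (if k is k'.+1 then
    iterated_integral x0 N (fun s => N s *m v s) k' t else v t) in
  forall k x, x \in `[a, b] ->
    has_vderiv_on a b (Phi k.+1) x (H x *m Phi k.+1 x + Z x *m Phi k x).
Proof.
move=> x0ab uM dM eN cv N Phi k x xab.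
rewrite -(mulmx_conjugated (Z := Z) uM)//.
apply: (has_vderiv_on_variation dM) => //.
have eu := exact_entries_mulmx eN cv.
by have := has_vderiv_on_iterated_integral k x0ab eN eu x xab; case: k.
Qed.

Theorem mainTheorem2 (R : realType) (n : nat) (hn : (1 <= n)%N)
    (a b : R) (hab : a < b)
    (A H Z M : R -> 'M[R]_n) (F : R -> 'cV[R]_n)
    (hA : nonsingular_on a b A) (hAc : continuous_entries a b A)
    (hFc : continuous_entries a b F)
    (hAHZ : forall x : R, x \in `[a, b] -> A x = H x + Z x)
    (hH : nonsingular_on a b H) (hZ : nonsingular_on a b Z)
    (hZf : finite_entries a b Z)
    (hM : fundamental_matrix a b H M)
    (x0 : R) (hx0 : x0 \in `[a, b]) (c : 'cV[R]_n) :
  (forall x : R, x \in `[a, b] ->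
     has_vderiv_on a b (Phi_tilde x0 M Z c 0) x
       (H x *m Phi_tilde x0 M Z c 0 x) /\
     forall j, (1 <= j)%N ->
       has_vderiv_on a b (Phi_tilde x0 M Z c j) x
         (H x *m Phi_tilde x0 M Z c j x + Z x *m Phi_tilde x0 M Z c j.-1 x)) /\
  (forall x : R, x \in `[a, b] ->
     has_vderiv_on a b (Phi_bar x0 M Z F c 0) x
       (H x *m Phi_bar x0 M Z F c 0 x + F x) /\
     forall j, (1 <= j)%N ->
       has_vderiv_on a b (Phi_bar x0 M Z F c j) x
         (H x *m Phi_bar x0 M Z F c j x + Z x *m Phi_bar x0 M Z F c j.-1 x)).
Proof.
have bH i j : bounded_on a b (fun x => H x i j).
  have [K hK] := continuous_bounded_on (hAc i j).
  have [L [_ hL]] := hZf i j.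
  exists (K + (L + 1)) => x xab.
  have -> : H x = A x - Z x by rewrite hAHZ// addrK.
  rewrite !mxE (le_trans (ler_normB _ _))// lerD ?hK//.
  by apply: hL => //; rewrite ltrDl.
have uM := fundamental_matrix_nonsingular bH hM.
have dM := fundamental_matrix_entry hM.
have eN := exact_entries_conjugated uM dM hab hAc hAHZ bH.
have cM := has_deriv_on_continuous_entries _ dM.
have cst_deriv x : has_vderiv_on a b (fun=> c) x 0.
  by move=> i; rewrite mxE; exact: has_deriv_on_cst.
split.
  move=> x xab; split.
    rewrite -[X in has_vderiv_on _ _ _ _ X]addr0 -[X in _ + X](mulmx0 _ (M x)).
    exact: (has_vderiv_on_variation dM xab (cst_deriv x)).
  have cc : continuous_entries a b (fun=> c).
    by apply: (has_vderiv_on_continuous (fun=> 0)) => y _; exact: cst_deriv.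
  case=> // k _.
  have := perturbation_recursion hx0 uM dM eN cc k x xab.
  by case: k.
pose w x := c + vintegral x0 x (fun t => invmx (M t) *m F t).
have eF : exact_entries a b (fun t => invmx (M t) *m F t).
  move=> i j; apply: continuous_exact_derivative.
  by apply: continuous_entries_mulmx => //; exact: continuous_entries_invmx.
have dw x : x \in `[a, b] -> has_vderiv_on a b w x (invmx (M x) *m F x).
  move=> xab i; have := has_deriv_onD (cst_deriv x i)
    (has_vderiv_on_vintegral hx0 eF x xab i).
  rewrite [X in X + _]mxE add0r; apply: has_deriv_on_eq => // t _.
  by rewrite [RHS]mxE.
have barE : Phi_bar0 x0 M F c = fun x => M x *m w x.
  by apply/funext => x; rewrite /Phi_bar0 /w mulmxDr.
move=> x xab; split.
  rewrite /Phi_bar barE -[X in _ + X]mul1mx -(mulmxV (uM x xab)) -mulmxA.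
  exact: (has_vderiv_on_variation dM xab (dw x xab)).
case=> // k _.
have cw := has_vderiv_on_continuous _ dw.
have := perturbation_recursion hx0 uM dM eN cw k x xab.
have uE : (fun t => invmx (M t) *m Z t *m Phi_bar0 x0 M F c t) =
    (fun t => conjugated M Z t *m w t).
  by apply/funext => t; rewrite barE /conjugated !mulmxA.
case: k => [|k]; rewrite /Phi_bar uE//.
by rewrite barE.
Qed.
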